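(* Let $r\ge 2$ and $d\ge 1$ be integers, let $n=(r-1)(d+1)+1$, and let $X=\{a_1,\ldots,a_n\}\subset \mathbb{R}^d$ be a set of $n$ points. Then $X$ is $r$-divisible.
   Context: A finite set $X\subset\mathbb{R}^d$ is called $r$-divisible if there is a partition of $X$ into $r$ parts $X_1,\ldots,X_r$ (pairwise disjoint, with union $X$) such that $\bigcap_{p=1}^r \mathrm{conv}\, X_p\neq\emptyset$, where $\mathrm{conv}$ denotes the convex hull. *)

(* Defs.v *)
From mathcomp Require Import all_boot all_order all_algebra.
From mathcomp Require Import mathcomp_extra boolp classical_sets functions.
From mathcomp Require Import cardinality reals convex.

Set Implicit Arguments.
Unset Strict Implicit.
Unset Printing Implicit Defensive.

Local Open Scope classical_set_scope.

Definition convex_hull (R : numDomainType) (M : lmodType R) (A : set M) : set M :=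
  smallest (@convex_set R M) A.

(* [partition] also asks the parts to be nonempty; this adds nothing, since the
   hull of an empty part is empty and so would be the intersection. *)
Definition r_divisible (R : numDomainType) (M : lmodType R) (r : nat)
    (X : set M) : Prop :=
  exists P : 'I_r -> set M,
    partition setT P X /\ \bigcap_(p in setT) convex_hull (P p) !=set0.

(* Main.v *)
Require Import Defs.
From mathcomp Require Import all_boot all_order all_algebra.
From mathcomp Require Import mathcomp_extra boolp classical_sets functions.
From mathcomp Require Import cardinality reals convex.
From mathcomp Require Import interval_inference topology normedtype derive.
From mathcomp Require Import ring lra.

(** The proof is Sarkaria's.  Write r = s + 1, m = d + 1 and N = s * m, so that
    there are N + 1 points a_i.  Lift each a_i to b_i = (a_i, 1) in R^m, and
    take r vectors v_0, ..., v_s in R^s whose linear relations are exactly the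
    multiples of v_0 + ... + v_s = 0.  For every i, the r tensors v_j (x) b_i of
    R^(s * m) have mean 0.  The colorful Caratheodory theorem, applied in R^N to
    these N + 1 color classes, selects one index f(i) for each i and convex
    weights l_i such that the sum of the l_i v_(f(i)) (x) b_i vanishes.
    Grouping the terms by the value of f, the relations between the v_j force
    the partial sums of l_i b_i over the fibers of f to be all equal
    ([balanced_partition]).  The last coordinate says that the r fibers have
    the same total weight, necessarily 1 / r > 0, and the other coordinates
    that their weighted means are one and the same point: the fibers of f form
    the required partition ([exists_tverberg_partition]).

    The colorful Caratheodory theorem ([colorful_caratheodory]) is proved by
    minimality.  Among all convex combinations of transversals, take one, z, of
    least norm; it exists because the simplex of weights is compact and there
    are finitely many transversals.  If z is not 0, minimality puts the whole
    transversal in the half-space of the y with <z, y> >= <z, z>, and the points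
    of positive weight on its boundary.  If all weights are positive, a
    linear relation between the N + 1 points of R^N lets one of the weights be
    cancelled without moving z ([tight_weights_vanish]).  The point of weight 0
    can then be replaced by any point of its color, in particular by one with
    <z, y> <= 0, which contradicts minimality. *)

Set Implicit Arguments.
Unset Strict Implicit.
Unset Printing Implicit Defensive.
Import Order.TTheory GRing.Theory Num.Theory.
Import numFieldNormedType.Exports.

Local Open Scope classical_set_scope.
Local Open Scope ring_scope.
Local Open Scope card_scope.

(** * Convex hulls *)

(** A weighted mean of points of [A] lies in its convex hull, even though
    convexity speaks of two points at a time: the mean of a list is a
    combination of its first point and of the mean of the others. *)
Lemma convex_hull_mean (R : numFieldType) (M : lmodType R) (A : set M)
    (I : eqType) (s : seq I) (P : pred I) (l : I -> R) (a : I -> M) :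
  (forall i, P i -> 0 <= l i) -> (forall i, P i -> A (a i)) ->
  0 < \sum_(i <- s | P i) l i ->
  convex_hull A
    ((\sum_(i <- s | P i) l i)^-1 *: \sum_(i <- s | P i) l i *: a i).
Proof.
move=> l_ge0 Aa sl C [Cconv AC]; move: sl.
have sum_ge0 s' : 0 <= \sum_(i <- s' | P i) l i by rewrite sumr_ge0.
elim: s => [|i s IHs]; first by rewrite big_nil ltxx.
rewrite !big_cons; case: ifPn => // Pi.
set m := \sum_(j <- s | P j) l j; set y := \sum_(j <- s | P j) _.
have [m0|m_neq0] := eqVneq m 0.
  have -> : y = 0.
    rewrite /y big1_seq// => j /andP[Pj js]; move/eqP: m0.
    rewrite psumr_eq0// => /allP/(_ j js); rewrite Pj/= => /eqP->.
    by rewrite scale0r.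
  rewrite m0 !addr0 => li_gt0.
  by rewrite scalerA mulVf ?gt_eqF// scale1r; exact/AC/Aa.
have m_gt0 : 0 < m by rewrite lt_neqAle eq_sym m_neq0 sum_ge0.
move=> lm_gt0.
have t_ge0 : 0 <= l i / (l i + m) by rewrite divr_ge0 ?l_ge0 ?ltW.
have t_le1 : l i / (l i + m) <= 1.
  by rewrite ler_pdivrMr// mul1r lerDl ltW.
have := Cconv (a i) (m^-1 *: y) (Itv01 t_ge0 t_le1).
rewrite !inE => /(_ (AC _ (Aa _ Pi)) (IHs m_gt0)).
congr (C _).
rewrite -[LHS]/(l i / (l i + m) *: a i + (1 - l i / (l i + m)) *: (m^-1 *: y)).
rewrite scalerDr !scalerA mulrC; congr (_ + _ *: _).
by field; rewrite gt_eqF//= gt_eqF.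
Qed.

Lemma convex_hull_set0 (R : numDomainType) (M : lmodType R) :
  convex_hull (@set0 M) = set0.
Proof.
by rewrite /convex_hull smallest_id// => x y t; rewrite inE.
Qed.

(** * The inner product *)

Section EuclideanSpace.
Variables (R : realFieldType) (n : nat).
Implicit Types (x y z : 'rV[R]_n).

(** The standard inner product of row vectors. *)
Definition dot x y : R := (x *m y^T) 0 0.

Lemma dotE x y : dot x y = \sum_k x 0 k * y 0 k.
Proof. by rewrite /dot mxE; apply: eq_bigr => k _; rewrite mxE. Qed.

Lemma dotC x y : dot x y = dot y x.
Proof. by rewrite !dotE; apply: eq_bigr => k _; rewrite mulrC. Qed.

Lemma dotDr x y z : dot x (y + z) = dot x y + dot x z.
Proof. by rewrite /dot linearD mulmxDr mxE. Qed.

Lemma dotDl x y z : dot (x + y) z = dot x z + dot y z.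
Proof. by rewrite /dot mulmxDl mxE. Qed.

Lemma dotZr x y (t : R) : dot x (t *: y) = t * dot x y.
Proof. by rewrite /dot linearZ/= -scalemxAr mxE. Qed.

Lemma dotZl x y (t : R) : dot (t *: x) y = t * dot x y.
Proof. by rewrite /dot -scalemxAl mxE. Qed.

Lemma dot0r x : dot x 0 = 0.
Proof. by rewrite /dot trmx0 mulmx0 mxE. Qed.

Lemma dot_sumr (I : finType) x (F : I -> 'rV[R]_n) :
  dot x (\sum_i F i) = \sum_i dot x (F i).
Proof. by rewrite /dot linear_sum mulmx_sumr summxE. Qed.

Lemma dot_ge0 x : 0 <= dot x x.
Proof. by rewrite dotE sumr_ge0// => k _; rewrite -expr2 sqr_ge0. Qed.

Lemma dot_eq0 x : (dot x x == 0) = (x == 0).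
Proof.
apply/eqP/eqP => [|->]; last by rewrite dot0r.
rewrite dotE => /eqP; rewrite psumr_eq0; last first.
  by move=> k _; rewrite -expr2 sqr_ge0.
move=> /allP x0; apply/rowP => k; rewrite mxE; apply/eqP.
by rewrite -[_ == 0]orbb -mulf_eq0; exact: x0 (mem_index_enum k).
Qed.

(** If [z] is the point nearest to the origin on the segment from [z] to [y],
    then [y] lies on or beyond the hyperplane through [z] orthogonal to [z]. *)
Lemma nearest_point_dot z y :
  (forall t : R, 0 <= t <= 1 ->
    dot z z <= dot ((1 - t) *: z + t *: y) ((1 - t) *: z + t *: y)) ->
  dot z z <= dot z y.
Proof.
move=> zmin; rewrite leNgt; apply/negP => lt_zy.
have y_ge0 : 0 <= dot (y - z) (y - z) := dot_ge0 _.
have dsub : dot (y - z) (y - z) = dot y y - 2 * dot z y + dot z z.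
  rewrite -scaleN1r !(dotDl, dotDr, dotZl, dotZr) (dotC y z); ring.
pose c := dot z z - dot z y; pose b := dot (y - z) (y - z).
have c_gt0 : 0 < c by rewrite subr_gt0.
have bc_gt0 : 0 < b + c by rewrite ltr_wpDl.
(* Going from z towards y by the fraction t changes the square norm by
   -2tc + t^2 b, which is negative for this t, as t b <= c. *)
pose t := c / (b + c).
have t_gt0 : 0 < t by rewrite divr_gt0.
have tbc : t * (b + c) = c by rewrite mulfVK ?gt_eqF.
have t01 : 0 <= t <= 1.
  by rewrite ltW//= ler_pdivrMr// mul1r lerDr.
have := zmin t t01.
have -> : dot ((1 - t) *: z + t *: y) ((1 - t) *: z + t *: y) =
          dot z z - t * (2 * c - t * b).
  rewrite /c /b dsub !(dotDl, dotDr, dotZl, dotZr) (dotC y z); ring.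
have -> : 2 * c - t * b = c + t * c by rewrite -{1}tbc; move: tbc; lra.
have : 0 < t * (c + t * c) by rewrite mulr_gt0// addr_gt0// mulr_gt0.
lra.
Qed.

End EuclideanSpace.

(** * Convex weights *)

(** The standard simplex: row vectors of nonnegative weights of sum 1. *)
Definition simplex (R : numDomainType) n : set 'rV[R]_n :=
  [set l | (forall i, 0 <= l 0 i) /\ \sum_i l 0 i = 1].

Lemma compact_simplex (R : realType) n : compact (@simplex R n).
Proof.
apply: (@subclosed_compact _ _
  [set l : 'rV[R]_n | forall i, `[0, 1]%classic (l ord0 i)]).
- rewrite (_ : @simplex R n =
      \bigcap_i (fun l : 'rV[R]_n => l 0 i) @^-1` [set x | 0 <= x] `&`
      (fun l : 'rV[R]_n => \sum_i l 0 i) @^-1` [set x | x = 1]); last first.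
    by apply/seteqP; split=> l [l0 l1]; split=> // i; [move=> _|]; exact: l0.
  apply: closedI.
    apply: closed_bigI => i _; apply: preimage_closed; last exact: closed_ge.
    by move=> l _; exact: coord_continuous.
  apply: preimage_closed; last exact: closed_eq.
  move=> l _; apply: (@continuous_big R _ +%R 0) => [|i _].
    exact: add_continuous.
  exact: coord_continuous.
- exact: rV_compact (fun i => @segment_compact _ _ _).
- move=> l [l0 l1] i /=; rewrite in_itv/= l0/= -l1 (bigD1 i)//= lerDl.
  by rewrite sumr_ge0.
Qed.

(** If the N + 1 rows of [W] in R^N all lie on the hyperplane through the mean
    z = l *m W orthogonal to z <> 0, then z is also a mean of the rows in which
    some row has weight 0.  A linear relation mu between the rows has sum 0, as
    one sees by pairing it with z, so that adding a multiple of mu to l keeps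
    both the total weight and z. *)
Lemma tight_weights_vanish (R : realFieldType) N (W : 'M[R]_(N.+1, N))
    (l : 'rV[R]_N.+1) :
  simplex l -> l *m W != 0 ->
  (forall i, dot (l *m W) (row i W) = dot (l *m W) (l *m W)) ->
  exists l', [/\ simplex l', l' *m W = l *m W & exists k, l' 0 k = 0].
Proof.
move=> [l_ge0 l1]; set z := l *m W => z0 zW.
have zz_neq0 : dot z z != 0 by rewrite dot_eq0.
have /rowV0Pn[mu /sub_kermxP muW mu0] : kermx W != 0.
  by rewrite -mxrank_eq0 mxrank_ker subn_eq0 -ltnNge ltnS rank_leq_col.
have sum_mu : \sum_i mu 0 i = 0.
  apply/eqP; rewrite -(mulIr_eq0 _ (mulIf zz_neq0)) mulr_suml.
  under eq_bigr => i _ do rewrite -(zW i) -dotZr.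
  by rewrite -dot_sumr -mulmx_sum_row muW dot0r.
have [k0 k0_lt0] : exists k, mu 0 k < 0.
  apply: contrapT => mu_ge0; move/eqP: mu0; apply.
  have {}mu_ge0 i : 0 <= mu 0 i.
    by rewrite leNgt; apply/negP => mui; apply: mu_ge0; exists i.
  apply/rowP => i; rewrite mxE.
  exact: (psumr_eq0P (fun i _ => mu_ge0 i) sum_mu).
(* The multiple of mu is the largest that keeps all weights nonnegative. *)
have [k k_lt0 kmin] :=
  @arg_minP _ _ _ k0 (fun i => mu 0 i < 0) (fun i => l 0 i / - mu 0 i) k0_lt0.
pose t := l 0 k / - mu 0 k.
have t_ge0 : 0 <= t by rewrite divr_ge0// oppr_ge0 ltW.
exists (l + t *: mu); split; last 2 first.
- by rewrite mulmxDl -scalemxAl muW scaler0 addr0.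
- by exists k; rewrite !mxE /t invrN mulrN mulNr mulfVK ?lt_eqF// subrr.
split=> [i|]; last first.
  under eq_bigr => i _ do rewrite !mxE.
  by rewrite big_split/= -mulr_sumr sum_mu mulr0 addr0.
rewrite !mxE; have [mui_ge0|mui_lt0] := leP 0 (mu 0 i).
  by rewrite addr_ge0// mulr_ge0.
by have := kmin i mui_lt0; rewrite ler_pdivlMr ?oppr_gt0// -/t; lra.
Qed.

Lemma nonneg_mean0_le0 (R : realDomainType) (J : finType) (c x : J -> R) :
  (forall j, 0 <= c j) -> \sum_j c j = 1 -> \sum_j c j * x j = 0 ->
  exists j, x j <= 0.
Proof.
move=> c_ge0 c1 cx0; apply: contrapT => x_gt0.
have {}x_gt0 j : 0 < x j.
  by rewrite ltNge; apply/negP => xj; apply: x_gt0; exists j.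
have c0 j : c j = 0.
  have /psumr_eq0P/(_ cx0 j isT)/eqP : forall j, true -> 0 <= c j * x j.
    by move=> i _; rewrite mulr_ge0// ltW.
  by rewrite mulf_eq0 (gt_eqF (x_gt0 j)) orbF => /eqP.
by move: c1; rewrite big1// => /esym/eqP; rewrite oner_eq0.
Qed.

(** * The colorful Caratheodory theorem *)

(** Given N + 1 finite families of vectors of R^N (the colors), each having 0 in
    its convex hull, 0 is a convex combination of a transversal, that is, of
    vectors picked one in each family. *)
Theorem colorful_caratheodory (R : realType) N (J : finType)
    (w : 'I_N.+1 -> J -> 'rV[R]_N) :
  (forall i, exists c : J -> R,
    [/\ forall j, 0 <= c j, \sum_j c j = 1 & \sum_j c j *: w i j = 0]) ->
  exists (f : 'I_N.+1 -> J) (l : 'rV[R]_N.+1),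
    simplex l /\ \sum_i l 0 i *: w i (f i) = 0.
Proof.
move=> w0.
pose W (f : {ffun 'I_N.+1 -> J}) : 'M[R]_(N.+1, N) := \matrix_i w i (f i).
have WE f (l : 'rV[R]_N.+1) : l *m W f = \sum_i l 0 i *: w i (f i).
  by rewrite mulmx_sum_row; apply: eq_bigr => i _; rewrite rowK.
pose q f (l : 'rV[R]_N.+1) := dot (l *m W f) (l *m W f).
have delta_simplex i : simplex (delta_mx 0 i : 'rV[R]_N.+1).
  split=> [j|]; first by rewrite mxE eqxx ler0n.
  rewrite (bigD1 i)//= mxE !eqxx big1 ?addr0// => j ji.
  by rewrite mxE eqxx (negPf ji).
have q_min f : exists l, simplex l /\ forall l', simplex l' -> q f l <= q f l'.
  have [||l] := @EVT_min_rV R N.+1 (q f) (@simplex R N.+1) _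
    (@compact_simplex R N.+1).
  - by exists (delta_mx 0 0).
  - apply: continuous_subspaceT.
    rewrite /q (_ : (fun _ => _) = fun l : 'rV[R]_N.+1 =>
        \sum_k (\sum_i l 0 i * W f i k) * (\sum_i l 0 i * W f i k)).
      apply: (@continuous_big R _ +%R 0) => [|k _]; first exact: add_continuous.
      suff lin_cont : continuous
          (fun l : 'rV[R]_N.+1 => \sum_i l 0 i * W f i k).
        by move=> l; apply: continuousM; exact: lin_cont.
      apply: (@continuous_big R _ +%R 0) => [|i _]; first exact: add_continuous.
      move=> l; apply: continuousM; first exact: coord_continuous.
      exact: cst_continuous.
    by apply/funext => l; rewrite dotE; apply: eq_bigr => k _; rewrite mxE.
  - rewrite inE => lS lmin; exists l; split=> // l' l'S.
    by apply: lmin; rewrite inE.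
have [L LP] := choice q_min.
have LS g : simplex (L g) := (LP g).1.
have Lmin g l : simplex l -> q g (L g) <= q g l := (LP g).2 l.
have [j0 _] : exists j : J, True.
  have [c [_ c1 _]] := w0 0.
  have [j _|J0] := pickP (@predT J); first by exists j.
  by move: c1; rewrite big_pred0// => /esym/eqP; rewrite oner_eq0.
have [f _ fmin] := @arg_minP _ _ _ [ffun=> j0] xpredT (fun f => q f (L f)) isT.
set z := L f *m W f.
have z_min g l : simplex l -> dot z z <= q g l.
  by move=> lS; apply: le_trans (fmin g isT) (Lmin g l lS).
(* Stated for any transversal g and weights l that represent z, and not only
   for f and L f, since it is applied again after an exchange. *)
have optimal g l : simplex l -> l *m W g = z ->
    forall i, dot z z <= dot z (w i (g i)).
  move=> [l_ge0 l1] lz i; apply: nearest_point_dot => t /andP[t_ge0 t_le1].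
  have <- : ((1 - t) *: l + t *: delta_mx 0 i) *m W g =
      (1 - t) *: z + t *: w i (g i).
    by rewrite mulmxDl -!scalemxAl lz -rowE rowK.
  apply: z_min; split=> [j|].
    by rewrite !mxE addr_ge0// mulr_ge0 ?subr_ge0// ?eqxx ler0n.
  under eq_bigr => j _ do rewrite !mxE.
  rewrite big_split/= -!mulr_sumr l1.
  have [_] := delta_simplex i; under eq_bigr do rewrite mxE.
  by move=> ->; rewrite !mulr1 subrK.
have [z0|z_neq0] := eqVneq z 0.
  by exists f, (L f); split; [exact: LS | rewrite -WE].
have z_gt0 : 0 < dot z z by rewrite lt_neqAle dot_ge0 eq_sym dot_eq0 z_neq0.
have [l [lS lz [k lk0]]] :
    exists l, [/\ simplex l, l *m W f = z & exists k, l 0 k = 0].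
  have [k0|L_neq0] := pselect (exists k, L f 0 k = 0).
    by exists (L f); split.
  apply: tight_weights_vanish => // i; rewrite rowK -/z.
  have Lf_ge0 j : 0 <= L f 0 j by have [] := LS f.
  (* The gaps <z, y> - <z, z> are nonnegative and have mean 0: they vanish
     wherever the weight is positive. *)
  have gap_ge0 j : true -> 0 <= L f 0 j * (dot z (w j (f j)) - dot z z).
    by move=> _; rewrite mulr_ge0// subr_ge0; exact: optimal (LS f) _ j.
  have : \sum_j L f 0 j * (dot z (w j (f j)) - dot z z) = 0.
    under eq_bigr do rewrite mulrBr -dotZr.
    rewrite sumrB -dot_sumr -WE -mulr_suml (LS f).2 mul1r.
    exact: subrr.
  move/(psumr_eq0P gap_ge0)/(_ i isT)/eqP.
  rewrite mulf_eq0 subr_eq0 => /orP[/eqP Li0|/eqP//].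
  by case: L_neq0; exists i.
have [c [c_ge0 c1 cw0]] := w0 k.
have [j zj_le0] : exists j, dot z (w k j) <= 0.
  apply: (nonneg_mean0_le0 c_ge0 c1).
  by under eq_bigr do rewrite -dotZr; rewrite -dot_sumr cw0 dot0r.
(* Exchanging the vector of weight 0 does not move z. *)
pose g := [ffun i => if i == k then j else f i].
have lgz : l *m W g = z.
  rewrite -lz !WE; apply: eq_bigr => i _; rewrite ffunE.
  by case: eqP => // ->; rewrite lk0 !scale0r.
have := optimal g l lS lgz k; rewrite ffunE eqxx => /le_trans/(_ zj_le0).
by rewrite leNgt z_gt0.
Qed.

(** * Sarkaria's tensor argument *)

(** Among s * m + 1 vectors of R^m there are convex weights and an assignment of
    the vectors to s + 1 classes for which all classes have the same weighted
    sum. *)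
Lemma balanced_partition (R : realType) (s m : nat)
    (b : 'I_(s * m).+1 -> 'rV[R]_m) :
  exists (f : 'I_(s * m).+1 -> 'I_s.+1) (l : 'rV[R]_(s * m).+1),
    simplex l /\ forall p, \sum_(i | f i == p) l 0 i *: b i =
                           \sum_(i | f i == ord_max) l 0 i *: b i.
Proof.
(* The v_j are the s basis vectors of R^s and, for the last index, minus
   their sum. *)
pose v (j : 'I_s.+1) : 'cV[R]_s :=
  \col_k ((j == lift ord_max k)%:R - (j == ord_max)%:R).
have sum_v : \sum_j v j = 0.
  apply/colP => k; rewrite summxE mxE; under eq_bigr do rewrite mxE.
  rewrite sumrB (bigD1 (lift ord_max k))//= eqxx big1 => [|j /negPf->//].
  rewrite (bigD1 ord_max)//= eqxx big1 => [|j /negPf->//].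
  by rewrite subrr.
have [i|f [l [lS]]] := @colorful_caratheodory R (s * m) 'I_s.+1
    (fun i j => mxvec (v j *m b i)).
  exists (fun=> s.+1%:R^-1); split=> [j||].
  - by rewrite invr_ge0 ler0n.
  - by rewrite sumr_const card_ord -(mulr_natr s.+1%:R^-1) mulVf// pnatr_eq0.
  - rewrite -scaler_sumr -linear_sum -mulmx_suml sum_v mul0mx.
    by rewrite linear0 scaler0.
under eq_bigr do rewrite -linearZ.
rewrite -linear_sum => /(canRL mxvecK); rewrite linear0 => sum0.
exists f, l; split=> // p; have [k ->|->//] := unliftP ord_max p.
apply/eqP; rewrite -subr_eq0; apply/eqP.
(* The k-th row of the vanishing combination of tensors compares the class of
   lift ord_max k with the last one. *)
rewrite [X in X - _]big_mkcond [X in _ - X]big_mkcond -sumrB.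
transitivity (row k (\sum_i l 0 i *: (v (f i) *m b i))); last first.
  by rewrite sum0 row0.
apply/rowP => h; rewrite mxE !summxE; apply: eq_bigr => i _.
rewrite !mxE big_ord1 !mxE.
do 2![case: ifP => _]; rewrite !mxE ?(subrr, subr0, sub0r);
  by rewrite ?(mulN1r, mul1r, mul0r, mulr0, mulrN).
Qed.

(** Tverberg's theorem for an indexed family, which may have repetitions. *)
Lemma exists_tverberg_partition (R : realType) (s d : nat)
    (a : 'I_(s * (d + 1)).+1 -> 'rV[R]_d) :
  exists f : 'I_(s * (d + 1)).+1 -> 'I_s.+1,
    \bigcap_p convex_hull (a @` [set i | f i = p]) !=set0.
Proof.
have [f [l [[l_ge0 l1] lf]]] :=
  balanced_partition (fun i => row_mx (a i) (const_mx 1 : 'rV_1)).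
pose mass p := \sum_(i | f i == p) l 0 i.
pose x p := \sum_(i | f i == p) l 0 i *: a i.
have liftE p : \sum_(i | f i == p) l 0 i *: row_mx (a i) (const_mx 1 : 'rV_1) =
    row_mx (x p) (const_mx (mass p)).
  rewrite /x /mass; apply: (big_ind3 (fun u v w => u = row_mx v (const_mx w))).
  - by rewrite -row_mx0; congr row_mx; apply/rowP => h; rewrite !mxE.
  - by move=> _ v w _ v' w' -> ->; rewrite add_row_mx -raddfD.
  - move=> i _; rewrite scale_row_mx; congr row_mx.
    by apply/rowP => h; rewrite !mxE mulr1.
have xmassE p : x p = x ord_max /\ mass p = mass ord_max.
  by move: (lf p); rewrite !liftE => /eq_row_mx[-> /rowP/(_ 0)]; rewrite !mxE.
have mass_gt0 : 0 < mass ord_max.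
  have : \sum_p mass p = 1 by rewrite -l1 (partition_big f xpredT).
  under eq_bigr do rewrite (xmassE _).2.
  rewrite sumr_const card_ord => massN; rewrite lt_neqAle sumr_ge0// andbT.
  by apply/eqP => m0; move: massN; rewrite -m0 mul0rn => /esym/eqP;
    rewrite oner_eq0.
exists f; exists ((mass ord_max)^-1 *: x ord_max) => p _.
rewrite -(xmassE p).1 -(xmassE p).2 /x /mass; apply: convex_hull_mean.
- by move=> i _; exact: l_ge0.
- by move=> i /eqP fi; exists i.
- by rewrite -/(mass p) (xmassE p).2.
Qed.

Theorem theorem1p1 (R : realType) (r d n : nat) (hr : (2 <= r)%N)
    (hd : (1 <= d)%N) (hn : n = ((r - 1) * (d + 1) + 1)%N)
    (X : set 'rV[R]_d) (hX : X #= `I_n) :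
  r_divisible r X.
Proof.
move: hX; rewrite {n}hn; case: r hr => // s _.
rewrite subn1/= [(_ + 1)%N]addn1 => /card_esym/card_set_bijP.
move=> [e [eX e_inj e_surj]].
have [f [x xP]] := @exists_tverberg_partition R s d (fun i => e i).
exists (fun p => (fun i : 'I__ => e i) @` [set i | f i = p]).
split; last by exists x.
split=> [||p _].
- apply/seteqP; split=> [_ [p _ [i _ <-]]|y /e_surj[i i_lt <-]].
    exact/eX/ltn_ord.
  by exists (f (Ordinal i_lt)) => //; exists (Ordinal i_lt).
- move=> p q _ _ [_ [[i <- <-] [j <- /e_inj ij]]].
  by congr f; apply/val_inj/esym/ij; rewrite inE; exact: ltn_ord.
- (* A hull containing x is not empty, hence neither is the part. *)
  apply/set0P/eqP => P0; have := xP p I.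
  by rewrite P0 convex_hull_set0.
Qed.
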